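(* Two quantum isomorphic planar graphs are isomorphic.
   Context: Graphs are finite, simple and undirected, with at least one vertex. A magic unitary with coefficients in a nonzero unital $C^*$-algebra $X$ is a square matrix whose entries are self-adjoint projections of $X$ with every row and column summing to $1_X$. Two graphs $G$ and $H$ with equally many vertices are quantum isomorphic if there is a magic unitary $U$, with coefficients in some nonzero unital $C^*$-algebra, rows indexed by $V(H)$ and columns by $V(G)$, with $U\,\mathrm{Adj}(G)=\mathrm{Adj}(H)\,U$ ($\mathrm{Adj}$ = adjacency matrix). *)

(* Defs.v *)
From HB Require Import structures.
From mathcomp Require Import all_boot all_order all_algebra.
From mathcomp Require Import complex.
From mathcomp Require Import all_classical all_reals all_analysis.
Set Implicit Arguments.
Unset Strict Implicit.
Unset Printing Implicit Defensive.
Import Order.TTheory GRing.Theory Num.Theory.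
Import numFieldNormedType.Exports.
Local Open Scope classical_set_scope.
Local Open Scope ring_scope.

(* Unital complex C*-algebras.  An [algType] has 1 != 0, so these are
   automatically nonzero.  The norm is part of the mixin because the hierarchy
   has no join of rings with normed modules. *)
HB.mixin Record isCstarAlgebra (R : realType) (A : Type)
    of GRing.Algebra R[i] A := {
  star : A -> A;
  starD : forall x y : A, star (x + y) = star x + star y;
  starZ : forall (a : R[i]) (x : A), star (a *: x) = a^* *: star x;
  starM : forall x y : A, star (x * y) = star y * star x;
  starK : involutive star;
  cnorm : A -> R;
  cnorm_eq0 : forall x : A, cnorm x = 0 -> x = 0;
  cnormZ : forall (a : R[i]) (x : A),
    cnorm (a *: x) = ComplexField.Normc.normc a * cnorm x;
  cnormD_le : forall x y : A, cnorm (x + y) <= cnorm x + cnorm y;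
  cnormM_le : forall x y : A, cnorm (x * y) <= cnorm x * cnorm y;
  cnorm_starM : forall x : A, cnorm (star x * x) = cnorm x ^+ 2;
  cnorm_complete : forall u : nat -> A,
    (forall eps : R, 0 < eps -> exists N : nat,
       forall m n : nat, (N <= m)%N -> (N <= n)%N ->
         cnorm (u m - u n) < eps) ->
    exists l : A, forall eps : R, 0 < eps -> exists N : nat,
      forall n : nat, (N <= n)%N -> cnorm (u n - l) < eps
}.

#[short(type="cstarAlgType")]
HB.structure Definition CstarAlgebra (R : realType) :=
  { A of GRing.Algebra R[i] A & isCstarAlgebra R A }.

Record graph := Graph {
  vertex :> finType;
  adj : rel vertex;
  adj_sym : symmetric adj;
  adj_irr : irreflexive adj;
  vertex_gt0 : (0 < #|vertex|)%N
}.

Definition graph_isomorphic (G H : graph) : Prop :=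
  exists2 f : G -> H, bijective f & forall x y, adj (f x) (f y) = adj x y.

(* Matrices with rows and columns indexed by arbitrary finite types. *)
Definition fmul (X : pzSemiRingType) (I J K : finType)
    (A : I -> J -> X) (B : J -> K -> X) : I -> K -> X :=
  fun i k => \sum_j A i j * B j k.

Definition Adj (X : pzSemiRingType) (G : graph) : G -> G -> X :=
  fun x y => (adj x y)%:R.

Definition is_projection (R : realType) (X : cstarAlgType R) (p : X) : Prop :=
  star p = p /\ p * p = p.

Definition magic_unitary (R : realType) (X : cstarAlgType R) (I J : finType)
    (U : I -> J -> X) : Prop :=
  [/\ #|I| = #|J|,
      forall i j, is_projection (U i j),
      forall i, \sum_j U i j = 1
    & forall j, \sum_i U i j = 1].

Definition quantum_isomorphic (R : realType) (G H : graph) : Prop :=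
  #|G| = #|H| /\
  exists (X : cstarAlgType R) (U : H -> G -> X),
    magic_unitary U /\ fmul U (@Adj X G) =2 fmul (@Adj X H) U.

(* A is a simple arc of the plane with endpoints a and b. *)
Definition is_arc (R : realType) (A : set (R * R)) (a b : R * R) : Prop :=
  exists f : R -> R * R,
    [/\ {within `[0, 1], continuous f},
        {in `[0, 1] &, injective f},
        f 0 = a, f 1 = b
      & A = f @` `[0, 1]].

(* G can be drawn in the plane: its vertices are distinct points and each edge
   xy is a simple arc [e x y] from x to y, which contains no vertex other than
   x and y, and which meets the arcs of the other edges only at vertices (hence
   only at common endpoints). *)
Definition planar (R : realType) (G : graph) : Prop :=
  exists (p : G -> R * R) (e : G -> G -> set (R * R)),
    [/\ injective p,
        forall x y, adj x y -> is_arc (e x y) (p x) (p y),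
        forall x y, adj x y -> e x y = e y x,
        forall x y z, adj x y -> e x y (p z) -> z = x \/ z = y
      & forall x y u v, adj x y -> adj u v ->
          (u, v) <> (x, y) -> (u, v) <> (y, x) ->
          e x y `&` e u v `<=` range p].

(* Main.v *)
(* A planar graph is a minor of a grid: with a mesh much finer than the distances
   between disjoint pieces of the drawing, the grid cells visited by the first
   third of every arc leaving a vertex form its branch set, extended along the
   middle third of one arc per edge until the other branch set is reached.  No
   separation property of the plane is used.

   If K is a minor of a grid, then hom(K, G) is, up to a power of #|G|, the
   number of labelings of the grid by G satisfying "equal" or "adjacent" marks on
   the grid edges.  This number is computed row by row, and the ordered products
   of entries of a magic unitary along a row intertwine each step of the
   computation for G and for H; hence hom(K, G) = hom(K, H).

   Finally, Lovasz's argument only needs grid minors K: hom(K, G) is the sum over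
   partitions of the number of embeddings in G of the quotients of K, and a
   quotient that embeds in G or in H is again a grid minor.  So embeddings are
   equinumerous too, and G and H embed in each other. *)
Require Import Defs.
From mathcomp Require Import all_boot all_algebra all_classical all_reals all_analysis.
From mathcomp Require Import all_order complex lra ring zify.
Set Implicit Arguments.
Unset Strict Implicit.
Unset Printing Implicit Defensive.
Import Order.TTheory GRing.Theory Num.Theory.
Import numFieldNormedType.Exports.
Local Open Scope ring_scope.

(** * Orthogonality of projections in a C*-algebra *)

Section CstarNorm.
Variables (R : realType) (X : cstarAlgType R).
Implicit Types (x y p q k : X) (r c : R).

Local Notation "r %:C" := (real_complex R r).

Lemma cnormZr r x : cnorm (r%:C *: x) = `|r| * cnorm x.
Proof. by rewrite cnormZ /= expr0n /= addr0 sqrtr_sqr. Qed.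

Lemma cnorm0 : cnorm (0 : X) = 0.
Proof. by rewrite -(scale0r (0 : X)) -[0 in LHS](rmorph0 (real_complex R)) cnormZr normr0 mul0r. Qed.

Lemma cnormN x : cnorm (- x) = cnorm x.
Proof.
by rewrite -scaleN1r -(rmorph1 (real_complex R)) -(rmorphN (real_complex R)) cnormZr normrN1 mul1r.
Qed.

Lemma cnorm_ge0 x : 0 <= cnorm x.
Proof.
have := cnormD_le x (- x); rewrite subrr cnorm0 cnormN => h; lra.
Qed.

Lemma ler_cnorm_sum (I : finType) (P : pred I) (F : I -> X) :
  cnorm (\sum_(i | P i) F i) <= \sum_(i | P i) cnorm (F i).
Proof.
elim/big_rec2: _ => [|i a b _ h]; first by rewrite cnorm0.
exact: le_trans (cnormD_le _ _) (lerD _ h).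
Qed.

Lemma star1 : star (1 : X) = 1.
Proof. by rewrite -[LHS]mulr1 -[X in _ * X]starK -starM mulr1 starK. Qed.

Lemma star0 : star (0 : X) = 0.
Proof. by rewrite -(scale0r (0 : X)) starZ rmorph0 !scale0r. Qed.

Lemma starN x : star (- x) = - star x.
Proof. by rewrite -scaleN1r starZ rmorphN1 scaleN1r. Qed.

Lemma projection_compl p : is_projection p -> is_projection (1 - p).
Proof.
case=> sp pp; split; first by rewrite starD starN star1 sp.
by rewrite mulrBl mul1r mulrBr mulr1 pp subrr subr0.
Qed.

Lemma cnorm_projection p : is_projection p -> cnorm p <= 1.
Proof.
case=> sp pp; have := cnorm_starM p; rewrite sp pp => h.
have := cnorm_ge0 p => h0; nra.
Qed.

(* The unit p of the corner pXp is an extreme point of its unit ball.  With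
   u = p + k and v = p - k, the identity
     c p + (n+1) k = (u ((c+1) p + n k) + v ((c-1) p + n k)) / 2
   makes |c p + n k| at most the mean of |S| for a simple random walk S of
   length n started at c, which is at most sqrt (c^2 + n). *)
Lemma corner_unit_extreme p k :
  p * p = p -> p * k = k -> k * p = k -> cnorm p <= 1 ->
  cnorm (p + k) <= 1 -> cnorm (p - k) <= 1 -> k = 0.
Proof.
move=> pp pk kp np nu nv.
(* The parameter [m] replaces the square root by |c| <= (c^2/m + m)/2. This bound is affine in c^2,
   so averaging it over c + 1 and c - 1 adds exactly 1 to c^2 + n. *)
have walk (m : R) : 0 < m -> forall (n : nat) (c : R),
  cnorm (c%:C *: p + (n%:R : R)%:C *: k) <= ((c ^+ 2 + n%:R) / m + m) / 2.
  move=> m0; elim=> [|n IH] c.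
    rewrite rmorph0 scale0r addr0 cnormZr.
    apply: (@le_trans _ _ `|c|).
      by rewrite -[leRHS]mulr1 ler_wpM2l.
    rewrite addr0 ler_pdivlMr // -(ler_pM2r m0) mulrDl divfK ?gt_eqF //.
    rewrite -real_normK ?num_real//.
    have := sqr_ge0 (`|c| - m); nra.
  have -> : c%:C *: p + (n.+1%:R : R)%:C *: k = (2^-1 : R)%:C *:
      ((p + k) * ((c + 1)%:C *: p + (n%:R : R)%:C *: k)
       + (p - k) * ((c - 1)%:C *: p + (n%:R : R)%:C *: k)).
    apply: (scalerI (a := 2)); first by rewrite pnatr_eq0.
    have half : 2 * (2^-1 : R)%:C = 1 :> R[i].
      by rewrite fmorphV -[2 in X in X / _](rmorph_nat (real_complex R)) mulfV// fmorph_eq0 pnatr_eq0.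
    rewrite scalerA half scale1r.
    rewrite mulrDl mulrBl !mulrDr -!scalerAr pp pk kp scaler_nat.
    rewrite rmorphB rmorphD rmorph1 -natr1 rmorphD rmorph1 !(scalerDl, scalerBl) scaleNr !scale1r.
    set a := _ *: p. set b := _ *: k; set d := _ *: k; set e := _ *: (k * k).
    rewrite !opprD ?opprK scaleN1r opprK !addrA mulr2n !addrA.
    by rewrite [RHS](ACl (1*3*5*7*9*11*(2*8)*(4*10)*(6*12)))%AC /= !subrr !addr0.
  rewrite cnormZr ger0_norm ?invr_ge0//.
  have h1 := IH (c + 1); have h2 := IH (c - 1).
  have := cnormD_le ((p + k) * ((c + 1)%:C *: p + (n%:R : R)%:C *: k)) ((p - k) * ((c - 1)%:C *: p + (n%:R : R)%:C *: k)).
  have := cnormM_le (p + k) ((c + 1)%:C *: p + (n%:R : R)%:C *: k).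
  have := cnormM_le (p - k) ((c - 1)%:C *: p + (n%:R : R)%:C *: k).
  set a := cnorm ((p + k) * _). set b := cnorm ((p - k) * _).
  move: h1 h2 (cnorm_ge0 (p + k)) (cnorm_ge0 (p - k))
    (cnorm_ge0 ((c + 1)%:C *: p + (n%:R : R)%:C *: k))
    (cnorm_ge0 ((c - 1)%:C *: p + (n%:R : R)%:C *: k)).
  set a' := cnorm (_ + _ *: k). set b' := cnorm (_ + _ *: k) => h1 h2 *.
  have ha : a <= a' by nra.
  have hb : b <= b' by nra.
  have hab : cnorm ((p + k) * ((c + 1)%:C *: p + (n%:R : R)%:C *: k) +
      (p - k) * ((c - 1)%:C *: p + (n%:R : R)%:C *: k)) <= a' + b' by lra.
  have E : ((c + 1) ^+ 2 + n%:R) / m + ((c - 1) ^+ 2 + n%:R) / m = 2 * ((c ^+ 2 + n.+1%:R) / m).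
    by rewrite -mulrDl mulrA; congr (_ / m); rewrite -natr1; ring.
  lra.
apply: cnorm_eq0; apply/eqP; rewrite eq_le cnorm_ge0 andbT leNgt; apply/negP => k0.
have [m m_gt] : exists m : nat, (cnorm k)^-1 < m%:R.
  by exists (Num.bound (cnorm k)^-1); rewrite archi_boundP// invr_ge0 cnorm_ge0.
have m0 : 0 < m%:R :> R by apply: lt_trans m_gt; rewrite invr_gt0.
(* With n = m^2 and c = 0 the bound reads m^2 |k| <= m, against the choice of [m] with m |k| > 1. *)
have := walk m%:R m0 (m ^ 2)%N 0; rewrite rmorph0 scale0r add0r cnormZr expr0n add0r natrX.
rewrite ger0_norm ?exprn_ge0 ?ler0n// expr2 mulfK ?gt_eqF//.
have h : 1 < m%:R * cnorm k by rewrite -ltr_pdivrMr// div1r.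
by clear -m0 h; nra.
Qed.

(** By the C*-identity it is enough that h = P i P j P i vanishes. Let m count the indices other
    than [i] and [j]. Compressing the sum to the corner of [P i] writes m (P i) + h as a sum of m
    terms P i - P i P l P i of norm at most 1, and m (P i) - h is m - 1 copies of [P i] plus one
    such term. So P i + h/m and P i - h/m lie in the unit ball, and extremality of the corner unit
    gives h = 0. *)
Lemma projections_orthogonal (I : finType) (P : I -> X) :
  (forall i, is_projection (P i)) -> \sum_i P i = 1 ->
  forall i j, i != j -> P i * P j = 0.
Proof.
move=> Pp P1 i j ij.
have [spi ppi] := Pp i; have [spj ppj] := Pp j.
pose h := P i * P j * P i.
suff h0 : h = 0.
  have : cnorm (star (P j * P i) * (P j * P i)) = 0.
    by rewrite starM spi spj !mulrA -(mulrA (P i)) ppj -/h h0 cnorm0.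
  rewrite cnorm_starM => /eqP; rewrite expf_eq0/= => /eqP/cnorm_eq0 ji0.
  by rewrite -[LHS]starK starM spi spj ji0 star0.
have hE : h = - \sum_(l | (l != i) && (l != j)) P i * P l * P i.
  have : \sum_l P i * P l * P i = P i.
    by rewrite -mulr_suml -mulr_sumr P1 mulr1 ppi.
  rewrite (bigD1 i)//= (bigD1 j)/=; last by rewrite eq_sym.
  rewrite ppi ppi -/h -[RHS]addr0 => /addrI/eqP.
  by rewrite addr_eq0 => /eqP.
have compl l : cnorm (P i - P i * P l * P i) <= 1.
  have -> : P i - P i * P l * P i = P i * (1 - P l) * P i.
    by rewrite mulrBr mulr1 mulrBl ppi.
  have n1 := cnorm_projection (Pp i).
  have n2 := cnorm_projection (projection_compl (Pp l)).
  have := cnormM_le (P i * (1 - P l)) (P i); have := cnormM_le (P i) (1 - P l).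
  have := cnorm_ge0 (P i); have := cnorm_ge0 (1 - P l); have := cnorm_ge0 (P i * (1 - P l)).
  nra.
pose m := #|[pred l | (l != i) && (l != j)]|.
have up : cnorm ((m%:R : R)%:C *: P i + h) <= m%:R.
  have -> : (m%:R : R)%:C *: P i + h =
      \sum_(l | (l != i) && (l != j)) (P i - P i * P l * P i).
    by rewrite sumrB hE sumr_const rmorph_nat scaler_nat.
  apply: le_trans (ler_cnorm_sum _ _) _.
  by apply: le_trans (ler_sum _ (fun l _ => compl l)) _; rewrite sumr_const.
have [m0|m_gt0] := posnP m.
  by rewrite hE big_pred0 ?oppr0// => l; have := card0_eq m0 l.
have down : cnorm ((m%:R : R)%:C *: P i - h) <= m%:R.
  rewrite -(prednK m_gt0) -natr1 rmorphD rmorph1 scalerDl scale1r -addrA.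
  apply: le_trans (cnormD_le _ _) (lerD _ (compl j)).
  rewrite cnormZr ger0_norm ?ler0n// -[leRHS]mulr1 ler_wpM2l ?ler0n//.
  exact: cnorm_projection.
have mR : 0 < m%:R :> R by rewrite ltr0n.
have mC : (m%:R : R)%:C != 0 by rewrite fmorph_eq0 gt_eqF.
have scaled (s : X) : cnorm ((m%:R : R)%:C *: P i + s) <= m%:R ->
    cnorm (P i + ((m%:R : R)%:C)^-1 *: s) <= 1.
  move=> hs; have -> : P i + ((m%:R : R)%:C)^-1 *: s =
     (m%:R^-1 : R)%:C *: ((m%:R : R)%:C *: P i + s).
    by rewrite fmorphV scalerDr scalerA mulVf// scale1r.
  by rewrite cnormZr gtr0_norm ?invr_gt0// mulrC ler_pdivrMr// mul1r.
suff k0 : ((m%:R : R)%:C)^-1 *: h = 0.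
  by apply: (scalerI (a := ((m%:R : R)%:C)^-1)); rewrite ?invr_eq0// k0 scaler0.
apply: (@corner_unit_extreme (P i)) => //.
- by rewrite -scalerAr /h !mulrA ppi.
- by rewrite -scalerAl /h -!mulrA ppi.
- exact: cnorm_projection.
- exact: scaled.
- by rewrite -scalerN; apply: scaled.
Qed.
End CstarNorm.

(** * Row by row counting of labelings *)

Lemma nat_of_forall (I : finType) (b : pred I) :
  ([forall i, b i] : nat) = (\prod_i (b i : nat))%N.
Proof.
have [/forallP h|] := boolP [forall i, b i].
  by rewrite big1 // => i _; rewrite h.
rewrite negb_forall => /existsP[i /negbTE hi].
by rewrite (bigD1 i)//= hi mul0n.
Qed.

Lemma prodr_consecutive_eq0 (A : pzSemiRingType) n (F : 'I_n -> A) (i j : 'I_n) :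
  (j : nat) = i.+1 -> F i * F j = 0 -> \prod_l F l = 0.
Proof.
move=> ji Fij.
have -> : \prod_l F l = \prod_(0 <= l < n) (if insub l is Some l' then F l' else 1).
  by rewrite big_mkord; apply: eq_bigr => l _; rewrite valK.
rewrite (@big_cat_nat _ _ _ i) ?(ltnW (ltn_ord i))//= [X in _ * X]big_ltn ?ltn_ord//.
rewrite -ji [X in _ * (_ * X)]big_ltn ?ltn_ord// !valK.
by rewrite [X in _ * X]mulrA Fij mul0r mulr0.
Qed.

(* A mark on a grid edge says which of "equal" and "adjacent" is required of
   the labels of its endpoints. *)
Definition mark_ok (G : graph) (mk : bool * bool) (a b : G) : bool :=
  (mk.1 ==> (a == b)) && (mk.2 ==> adj a b).

Lemma mark_okC (G : graph) mk (a b : G) : mark_ok mk a b = mark_ok mk b a.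
Proof. by rewrite /mark_ok eq_sym adj_sym. Qed.

Section Rows.
Variables (W : finType) (h : nat -> pred W) (v : nat -> rel W).

(** A transfer-matrix recursion: [h] constrains each row, [v] each pair of consecutive rows, and [a]
    is the last of [m.+1] rows. *)
Fixpoint row_count m (a : W) : nat :=
  match m with
  | 0%N => h 0%N a
  | m'.+1 => (h m'.+1 a * \sum_b row_count m' b * v m' b a)%N
  end.

Definition rows_ok m (r : {ffun 'I_m.+1 -> W}) : bool :=
  [forall i : 'I_m.+1, h i (r i)] && [forall i : 'I_m, v i (r (widen_ord (leqnSn m) i)) (r (lift ord0 i))].

(** The weight [g] on the last row is there for the induction: removing the last row [a] leaves
    shorter stacks weighted by [v m _ a]. *)
Lemma sum_rows_ok m (g : W -> nat) :
  (\sum_(r : {ffun 'I_m.+1 -> W}) rows_ok r * g (r ord_max) = \sum_a row_count m a * g a)%N.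
Proof.
elim: m g => [|m IH] g.
  rewrite (reindex (fun a : W => [ffun _ : 'I_1 => a])) /=; last first.
    exists (fun r : {ffun 'I_1 -> W} => r ord0) => [a _|r _]; first by rewrite ffunE.
    by apply/ffunP => i; rewrite ffunE (ord1 i).
  apply: eq_bigr => a _; rewrite /rows_ok ffunE; congr (nat_of_bool _ * _)%N.
  apply/andP/idP => [[/forallP/(_ ord0)]|ha]; first by rewrite ffunE.
  by split; apply/forallP => -[i hi] //; rewrite ffunE /=; case: i hi.
pose ext (p : W * {ffun 'I_m.+1 -> W}) : {ffun 'I_m.+2 -> W} :=
  [ffun i => if unlift ord_max i is Some j then p.2 j else p.1].
rewrite (reindex ext) /=; last first.
  exists (fun r : {ffun 'I_m.+2 -> W} => (r ord_max, [ffun j => r (lift ord_max j)])).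
    move=> [a r] _; rewrite /ext ffunE unlift_none /=; congr (_, _).
    by apply/ffunP => j; rewrite !ffunE liftK.
  move=> r _; apply/ffunP => i; rewrite ffunE /=.
  by case: unliftP => [j ->|->] //; rewrite ffunE.
rewrite -(pair_bigA _ (fun a r => rows_ok (ext (a, r)) * g (ext (a, r) ord_max)))%N /=.
apply: eq_bigr => a _.
have extM r : ext (a, r) ord_max = a by rewrite ffunE unlift_none.
have extL r j : ext (a, r) (lift ord_max j) = r j by rewrite ffunE liftK.
have okE r : rows_ok (ext (a, r)) = rows_ok r && (h m.+1 a && v m (r ord_max) a).
  rewrite /rows_ok.
  have -> : [forall i : 'I_m.+2, h i (ext (a, r) i)] =
      [forall i : 'I_m.+1, h i (r i)] && h m.+1 a.
    apply/forallP/andP => [H|[/forallP H ha] i].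
      split; last by have := H ord_max; rewrite extM.
      by apply/forallP => i; have := H (lift ord_max i); rewrite extL lift_max.
    by case: (unliftP ord_max i) => [j ->|->]; rewrite ?extM// extL lift_max.
  have -> : [forall i : 'I_m.+1, v i (ext (a, r) (widen_ord (leqnSn m.+1) i))
       (ext (a, r) (lift ord0 i))] =
      [forall i : 'I_m, v i (r (widen_ord (leqnSn m) i)) (r (lift ord0 i))]
      && v m (r ord_max) a.
    have wid (j : 'I_m.+1) : widen_ord (leqnSn m.+1) j = lift ord_max j.
      by apply: ord_inj; rewrite lift_max.
    have last : lift ord0 (ord_max : 'I_m.+1) = ord_max by apply: ord_inj.
    have inner (j : 'I_m) : lift ord0 (widen_ord (leqnSn m) j) = lift ord_max (lift ord0 j).
      by apply: ord_inj; rewrite lift_max.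
    apply/forallP/andP => [H|[/forallP H ha] i].
      split; last by have := H ord_max; rewrite last extM wid extL.
      by apply/forallP => i; have := H (widen_ord (leqnSn m) i); rewrite wid extL inner extL.
    case: (unliftP ord_max i) => [j ->|->]; last by rewrite last extM wid extL.
    have -> : lift ord_max j = widen_ord (leqnSn m) j by apply: ord_inj; rewrite lift_max.
    by rewrite wid extL inner extL; exact: H.
  by rewrite -!andbA; do 3!bool_congr; rewrite andbC.
under eq_bigr do rewrite okE extM -mulnb -mulnb.
rewrite -(IH (fun b => v m b a : nat)) big_distrr big_distrl /=.
by apply: eq_bigr => r _; rewrite !mulnA (mulnC (rows_ok r)).
Qed.
End Rows.

Definition word_ok (G : graph) n (mk : 'I_n -> 'I_n -> bool * bool) (a : {ffun 'I_n -> G}) :=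
  [forall i : 'I_n, forall j : 'I_n, ((j : nat) == i.+1) ==> mark_ok (mk i j) (a i) (a j)].

Definition words_ok (G : graph) n (mk : 'I_n -> bool * bool) (a b : {ffun 'I_n -> G}) :=
  [forall i, mark_ok (mk i) (a i) (b i)].

(** * Magic unitaries intertwine the row counts *)

Section Magic.
Variables (R : realType) (G H : graph) (X : cstarAlgType R) (U : H -> G -> X).
Hypothesis (magicU : magic_unitary U).
Hypothesis (UA : fmul U (@Adj X G) =2 fmul (@Adj X H) U).

Lemma magic_row_orth x a b : a != b -> U x a * U x b = 0.
Proof. by case: magicU => _ Up Ur _; apply: (projections_orthogonal (P := U x)). Qed.

Lemma magic_col_orth x y a : x != y -> U x a * U y a = 0.
Proof. by case: magicU => _ Up _ Uc; apply: (projections_orthogonal (P := U^~ a)). Qed.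

(* Compute U x a (U Adj(G)) x b U y b in two ways. *)
Lemma magic_adj_orth x y a b : adj a b != adj x y -> U x a * U y b = 0.
Proof.
case: magicU => _ Up _ _ ab_xy.
have E := UA x b; rewrite /fmul /Adj in E.
have : U x a * (\sum_c U x c * (adj c b)%:R) * U y b =
       U x a * (\sum_z (adj x z)%:R * U z b) * U y b by rewrite E.
rewrite (bigD1 a)//= (bigD1 y)//= !mulrDr !mulrDl.
rewrite big_distrr big_distrl /= big1 ?addr0; last first.
  by move=> c ca; rewrite mulrA magic_row_orth 1?eq_sym// !mul0r.
rewrite big_distrr big_distrl /= [X in _ = _ + X]big1 ?addr0; last first.
  by move=> z zy; rewrite -!mulrA magic_col_orth // !mulr0.
have [_ Ua] := Up x a; have [_ Ub] := Up y b.
rewrite mulrA Ua -!mulrA [X in _ = U x a * X]mulrA.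
by case: (adj a b) (adj x y) ab_xy => -[]//= _; rewrite ?(mul1r, mul0r, mulr0, mulr1) ?Ub.
Qed.

Lemma magic_mark_orth mk x y a b :
  mark_ok mk a b != mark_ok mk x y -> U x a * U y b = 0.
Proof.
have [ab_xy|/magic_adj_orth //] := eqVneq (adj a b) (adj x y).
rewrite /mark_ok ab_xy.
have [->|ab] := eqVneq a b; have [->|xy] := eqVneq x y; rewrite ?eqxx// => _.
  exact: magic_col_orth.
exact: magic_row_orth.
Qed.

(** Insert 1 as a column sum on one side and as a row sum on the other; orthogonality kills every
    product [U x a * U y b] for which the two marks differ. *)
Lemma magic_mark_intertwine mk x b :
  \sum_a U x a *+ mark_ok mk b a = \sum_y U y b *+ mark_ok mk y x.
Proof.
case: magicU => _ _ Ur Uc.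
transitivity (\sum_a \sum_y U x a * U y b *+ mark_ok mk b a).
  by apply: eq_bigr => a _; rewrite sumrMnl -mulr_sumr Uc mulr1.
rewrite exchange_big/=; apply: eq_bigr => y _.
transitivity (\sum_a U x a * U y b *+ mark_ok mk y x).
  apply: eq_bigr => a _; rewrite mark_okC (mark_okC _ y).
  have [->//|/magic_mark_orth->] := eqVneq (mark_ok mk a b) (mark_ok mk x y).
  by rewrite !mul0rn.
by rewrite sumrMnl -mulr_suml Ur mul1r.
Qed.

Section Words.
Variable n : nat.
Implicit Types (x y : {ffun 'I_n -> H}) (a b : {ffun 'I_n -> G}).

(** An entry of the n-th tensor power of [U], multiplied in the order of the letters. As the factors
    need not commute, it is in general no projection, but rows and columns still sum to 1. *)
Definition word_coef x a : X := \prod_i U (x i) (a i).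

Lemma word_coef_row x : \sum_a word_coef x a = 1.
Proof.
case: magicU => _ _ Ur _.
by rewrite -(bigA_distr_bigA (fun i c => U (x i) c)) big1.
Qed.

Lemma word_coef_col a : \sum_x word_coef x a = 1.
Proof.
case: magicU => _ _ _ Uc.
by rewrite -(bigA_distr_bigA (fun i z => U z (a i))) big1.
Qed.

(** If exactly one of the two words is valid, some consecutive letters have differing marks, and the
    corresponding factors, side by side in the product, are orthogonal. *)
Lemma word_coef_ok mk x a : word_coef x a *+ word_ok mk a = word_coef x a *+ word_ok mk x.
Proof.
suff: word_ok mk a != word_ok mk x -> word_coef x a = 0.
  by have [->//|_ ->//] := eqVneq (word_ok mk a) (word_ok mk x); rewrite !mul0rn.
move=> ax.
have [i /existsP[j /andP[/eqP ji mij]]] : exists i : 'I_n, [exists j : 'I_n,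
   ((j : nat) == i.+1) && (mark_ok (mk i j) (a i) (a j) != mark_ok (mk i j) (x i) (x j))].
  apply/existsP; apply: contraNT ax; rewrite negb_exists => /forallP same.
  apply/eqP; apply: eq_forallb => i; apply: eq_forallb => j.
  have [ji/=|//] := eqVneq (j : nat) i.+1.
  have := same i; rewrite negb_exists => /forallP/(_ j).
  by rewrite ji eqxx /= negbK => /eqP.
by apply: (prodr_consecutive_eq0 ji); apply: magic_mark_orth mij.
Qed.

(** Vertical marks act letter by letter, so both sides factor as ordered products of the one-letter
    identity. *)
Lemma word_coef_intertwine mk x b :
  \sum_a word_coef x a *+ words_ok mk b a = \sum_y word_coef y b *+ words_ok mk y x.
Proof.
under eq_bigr do rewrite nat_of_forall -prodrMn.
under [RHS]eq_bigr do rewrite nat_of_forall -prodrMn.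
rewrite -(bigA_distr_bigA (fun i c => U (x i) c *+ mark_ok (mk i) (b i) c)).
rewrite -(bigA_distr_bigA (fun i z => U z (b i) *+ mark_ok (mk i) z (x i))).
by apply: eq_bigr => i _; apply: magic_mark_intertwine.
Qed.

Section RowCount.
Variables (hm : nat -> 'I_n -> 'I_n -> bool * bool) (vm : nat -> 'I_n -> bool * bool).
Let ZG := row_count (fun i => @word_ok G n (hm i)) (fun i => @words_ok G n (vm i)).
Let ZH := row_count (fun i => @word_ok H n (hm i)) (fun i => @words_ok H n (vm i)).

(** Induction on rows: horizontal marks pass from [a] to [x] by [word_coef_ok], and the vertical
    step passes through the coefficients by [word_coef_intertwine]. *)
Lemma word_coef_row_count m x : \sum_a word_coef x a *+ ZG m a = 1 *+ ZH m x.
Proof.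
elim: m x => [|m IH] x /=.
  under eq_bigr do rewrite word_coef_ok.
  by rewrite sumrMnl word_coef_row.
under eq_bigr do rewrite mulrnA word_coef_ok -mulrnA mulnC mulrnA.
rewrite sumrMnl mulnC mulrnA; congr (_ *+ _).
transitivity (\sum_a \sum_b word_coef x a *+ (ZG m b * words_ok (vm m) b a)).
  by apply: eq_bigr => a _; rewrite sumrMnr.
transitivity (\sum_y 1 *+ (ZH m y * words_ok (vm m) y x) : X); last exact: sumrMnr.
rewrite exchange_big /=.
transitivity (\sum_b (\sum_a word_coef x a *+ words_ok (vm m) b a) *+ ZG m b).
  apply: eq_bigr => b _; rewrite -sumrMnl; apply: eq_bigr => a _.
  by rewrite -mulrnA mulnC.
transitivity (\sum_b \sum_y word_coef y b *+ words_ok (vm m) y x *+ ZG m b).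
  by apply: eq_bigr => b _; rewrite word_coef_intertwine sumrMnl.
rewrite exchange_big /=; apply: eq_bigr => y _.
by rewrite [RHS]mulrnA -IH -sumrMnl; apply: eq_bigr => b _; rewrite -!mulrnA mulnC.
Qed.

Lemma sum_row_count_eq m : (\sum_a ZG m a = \sum_x ZH m x)%N.
Proof.
have : (\sum_a ZG m a)%:R = (\sum_x ZH m x)%:R :> X.
  rewrite -!sumrMnr.
  under [RHS]eq_bigr do rewrite -word_coef_row_count.
  rewrite exchange_big; apply: eq_bigr => a _.
  by rewrite sumrMnl word_coef_col.
(* Natural numbers embed in [X] through the complex scalars, injectively since 1 is nonzero. *)
rewrite -!(rmorph_nat (in_alg X)) => /fmorph_inj/eqP.
by rewrite eqr_nat => /eqP.
Qed.
End RowCount.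
End Words.
End Magic.

Local Close Scope ring_scope.

(** * Homomorphisms from grid minors *)

Definition grid_next m n (u v : 'I_m * 'I_n) : bool :=
  ((u.1 == v.1) && ((v.2 : nat) == u.2.+1)) || ((u.2 == v.2) && ((v.1 : nat) == u.1.+1)).

Definition grid_adj m n (u v : 'I_m * 'I_n) : bool := grid_next u v || grid_next v u.

Definition labelings (G : graph) m n (mk : 'I_m.+1 * 'I_n -> 'I_m.+1 * 'I_n -> bool * bool) :=
  [set r : {ffun 'I_m.+1 -> {ffun 'I_n -> G}} |
    [forall u, forall v, grid_next u v ==> mark_ok (mk u v) (r u.1 u.2) (r v.1 v.2)]].

Lemma card_labelings (G : graph) m n (mk : 'I_m.+1 * 'I_n -> 'I_m.+1 * 'I_n -> bool * bool) :
  #|labelings G mk| = \sum_a row_count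
    (fun i => @word_ok G n (fun j j' => mk (inord i, j) (inord i, j')))
    (fun i => @words_ok G n (fun j => mk (inord i, j) (inord i.+1, j))) m a.
Proof.
under [RHS]eq_bigr do rewrite -[row_count _ _ _ _]muln1.
rewrite -(sum_rows_ok _ _ m (fun=> 1)) -sum1_card big_mkcond /=.
apply: eq_bigr => r _; rewrite muln1 inE.
set b := rows_ok _ _ _; suff -> : [forall u, forall v,
    grid_next u v ==> mark_ok (mk u v) (r u.1 u.2) (r v.1 v.2)] = b by case: b.
apply/forallP/andP => [H|[/forallP Hh /forallP Hv] [i j]].
  split; apply/forallP => i.
    apply/forallP => j; apply/forallP => j'; apply/implyP => jj'.
    have /forallP/(_ (i, j')) := H (i, j).
    by rewrite /grid_next /= eqxx jj' /= inord_val.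
  apply/forallP => j; have /forallP/(_ (lift ord0 i, j)) := H (widen_ord (leqnSn m) i, j).
  rewrite /grid_next /= !eqxx orbT /=.
  have -> : inord i = widen_ord (leqnSn m) i by apply: ord_inj; rewrite inordK// ltnS ltnW.
  by have -> : inord i.+1 = lift ord0 i by apply: ord_inj; rewrite inordK// ltnS.
apply/forallP => -[i' j']; apply/implyP => /orP[]/= /andP[/eqP/= E /eqP/= E'].
  have /forallP/(_ j)/forallP/(_ j') := Hh i; rewrite E' eqxx inord_val /=.
  by rewrite -E.
have im : i < m by rewrite -ltnS -E' ltn_ord.
have /forallP/(_ j) := Hv (Ordinal im); rewrite /=.
have -> : widen_ord (leqnSn m) (Ordinal im) = i by apply: ord_inj.
have -> : inord i.+1 = i' by apply: ord_inj; rewrite -E' inord_val.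
have -> : lift ord0 (Ordinal im) = i' by apply: ord_inj; rewrite E'.
by rewrite inord_val -E.
Qed.

Lemma quantum_isomorphic_card_labelings (R : realType) (G H : graph) m n
    (mk : 'I_m.+1 * 'I_n -> 'I_m.+1 * 'I_n -> bool * bool) :
  quantum_isomorphic R G H -> #|labelings G mk| = #|labelings H mk|.
Proof.
case=> _ [X [U [magicU UA]]]; rewrite !card_labelings.
exact: (sum_row_count_eq magicU UA (fun i j j' => mk (inord i, j) (inord i, j'))
  (fun i j => mk (inord i, j) (inord i.+1, j))).
Qed.

Definition homs (K : finType) (e : rel K) (G : graph) :=
  [set f : {ffun K -> G} | [forall x, forall y, e x y ==> adj (f x) (f y)]].

(* [beta] assigns grid points to branch sets and [c x] is a root of the branch set of x. *)
Definition grid_model m n (K : finType) (e : rel K)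
    (beta : 'I_m * 'I_n -> option K) (c : K -> 'I_m * 'I_n) : Prop :=
  [/\ forall x, beta (c x) = Some x,
      forall u x, beta u = Some x ->
        connect (fun v w => grid_adj v w && (beta v == beta w)) (c x) u
    & forall x y, e x y -> exists u v,
        [/\ grid_adj u v, beta u = Some x & beta v = Some y]].

Definition grid_minor (K : finType) (e : rel K) : Prop :=
  exists m n (beta : 'I_m.+1 * 'I_n -> option K) c, grid_model e beta c.

Section Counting.
Variables (m n : nat) (K : finType) (e : rel K).
Variables (beta : 'I_m.+1 * 'I_n -> option K) (c : K -> 'I_m.+1 * 'I_n).
Hypotheses (e_sym : symmetric e) (model : grid_model e beta c).

(** Equality is required inside a branch set, adjacency between branch sets of adjacent vertices.
    The test [beta u != None] leaves points outside all branch sets free. *)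
Definition model_mark u v : bool * bool :=
  ((beta u == beta v) && (beta u != None),
   if (beta u, beta v) is (Some x, Some y) then e x y else false).

Lemma model_markC u v : model_mark u v = model_mark v u.
Proof.
rewrite /model_mark eq_sym; case: (beta u) (beta v) => [x|] [y|] //=.
by rewrite e_sym.
Qed.

(** Equality marks propagate along the paths joining a branch set to its root. As every edge of [e]
    is realized by a grid edge, the adjacency marks then say that the root labels form a
    homomorphism. *)
Lemma mem_model_labelings (G : graph) (r : {ffun 'I_m.+1 -> {ffun 'I_n -> G}}) :
  reflect ([ffun x => r (c x).1 (c x).2] \in homs e G /\
           forall u x, beta u = Some x -> r u.1 u.2 = r (c x).1 (c x).2)
          (r \in labelings G model_mark).
Proof.
case: model => bc conn edge; rewrite !inE; apply: (iffP forallP) => [H|[/forallP hom same] u].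
  have {}H u v : grid_adj u v -> mark_ok (model_mark u v) (r u.1 u.2) (r v.1 v.2).
    case/orP => uv; last rewrite model_markC mark_okC.
      by have /forallP/(_ v)/implyP := H u; apply.
    by have /forallP/(_ u)/implyP := H v; apply.
  have same u x : beta u = Some x -> r u.1 u.2 = r (c x).1 (c x).2.
    move=> bu; have /connectP[p] := conn _ _ bu; have := bc x.
    elim: p (c x) => [|w p IH] v bv /= ; first by move=> _ ->.
    case/andP => /andP[/H/andP[/= mk _] /eqP bvw] pth uE.
    rewrite (IH w) -?bvw //; apply/eqP.
    by rewrite eq_sym; move: mk; rewrite -bvw bv eqxx.
  split=> //; apply/forallP => x; apply/forallP => y; apply/implyP => exy.
  have [u [v [/H uv bu bv]]] := edge x y exy.
  rewrite !ffunE -(same u x)// -(same v y)//.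
  by case/andP: uv => _; rewrite /= bu bv exy.
apply/forallP => v; apply/implyP => _; rewrite /mark_ok /model_mark /=.
case Eu: (beta u) => [x|]; case Ev: (beta v) => [y|] //=; rewrite ?andbF//=.
rewrite (same u x)// (same v y)//; apply/andP; split.
  by apply/implyP; rewrite andbT => /eqP[->].
by have /forallP/(_ y) := hom x; rewrite !ffunE.
Qed.

Lemma card_model_labelings : exists w : nat -> nat, forall G : graph,
  0 < w #|G| /\ #|labelings G model_mark| = #|homs e G| * w #|G|.
Proof.
have [bc _ _] := model.
(* This is [g] to the power of the number of free grid points, in the nested shape that
   [card_family] produces. *)
exists (fun g => foldr muln 1 [seq foldr muln 1 [seq (if beta (i, j) is None then g else 1)
   | j : 'I_n] | i : 'I_m.+1]) => G; split.
  have pos (I : finType) (f : I -> nat) : (forall i, 0 < f i) -> 0 < foldr muln 1 [seq f i | i : I].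
    by move=> fp; rewrite /image_mem; elim: (enum _) => //= i s; rewrite muln_gt0 fp.
  by apply: (pos) => i; apply: (pos) => j; case: (beta _) => //; exact: vertex_gt0.
rewrite -sum1_card (partition_big (fun r : {ffun 'I_m.+1 -> {ffun 'I_n -> G}} =>
  [ffun x => r (c x).1 (c x).2]) (mem (homs e G))) /=; last first.
  by move=> r /mem_model_labelings[].
rewrite -sum_nat_const; apply: eq_bigr => f fh; rewrite sum1_card.
pose F i j : pred G := if beta (i, j) is Some x then pred1 (f x) else predT.
have -> : #|[pred r | (r \in labelings G model_mark) && ([ffun x => r (c x).1 (c x).2] == f)]| =
    #|family (fun i => family (F i) : pred {ffun 'I_n -> G})|.
  apply: eq_card => r; rewrite [in LHS]inE; apply/andP/familyP => [[/mem_model_labelings[_ same]]|rF].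
    move=> /eqP rf i; apply/familyP => j; rewrite /F.
    case E: (beta (i, j)) => [x|] //; rewrite inE; have := same _ _ E => /= ->.
    by rewrite -rf ffunE.
  have rb u x : beta u = Some x -> r u.1 u.2 = f x.
    case: u => i j E; have /familyP/(_ j) := rF i.
    by rewrite /F E inE => /eqP.
  have rf : [ffun x => r (c x).1 (c x).2] = f.
    by apply/ffunP => x; rewrite ffunE; apply: rb.
  split; last by rewrite rf.
  apply/mem_model_labelings; rewrite rf; split=> // u x E.
  by rewrite (rb u x)// (rb (c x) x).
rewrite card_family; congr foldr; apply: eq_map => i; rewrite card_family.
congr foldr; apply: eq_map => j; rewrite /F.
by case: (beta _) => [x|]; rewrite ?card1 ?cardT' //; apply: eq_card.
Qed.
End Counting.

Theorem quantum_isomorphic_card_homs (R : realType) (G H : graph) (K : finType) (e : rel K) :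
  quantum_isomorphic R G H -> symmetric e -> grid_minor e -> #|homs e G| = #|homs e H|.
Proof.
move=> q e_sym [m [n [beta [c model]]]].
have [w hw] := card_model_labelings e_sym model.
have := quantum_isomorphic_card_labelings (model_mark e beta) q.
have [wG ->] := hw G; have [_ ->] := hw H; have [<- _] := q.
by move/eqP; rewrite eqn_pmul2r// => /eqP.
Qed.

(** * Counting embeddings *)

(** Branch sets of vertices outside the image of [f] are discarded, the others kept. *)
Lemma grid_minor_sub (K K' : finType) (e : rel K) (e' : rel K') (f : K' -> K) :
  injective f -> (forall x y, e' x y -> e (f x) (f y)) -> grid_minor e -> grid_minor e'.
Proof.
move=> f_inj f_hom [m [n [beta [c [bc conn edge]]]]].
pose back y := [pick x | f x == y].
have backf x : back (f x) = Some x.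
  by rewrite /back; case: pickP => [y /eqP/f_inj->//|/(_ x)]; rewrite eqxx.
have backP y x : back y = Some x -> y = f x.
  by rewrite /back; case: pickP => // z /eqP<- [->].
exists m, n, (fun u => obind back (beta u)), (c \o f); split=> [x|u x|x y exy] /=.
- by rewrite bc /= backf.
- case bu: (beta u) => [y|]//= /backP y_fx; rewrite y_fx in bu.
  apply: connect_sub (conn _ _ bu) => v w /andP[vw /eqP bvw].
  by apply: connect1; rewrite vw bvw eqxx.
- have [u [v [uv bu bv]]] := edge _ _ (f_hom _ _ exy).
  by exists u, v; rewrite bu bv /= !backf.
Qed.

Definition injs (K : finType) (e : rel K) (G : graph) := [set f in homs e G | injectiveb f].

Definition kernel (K : finType) (G : graph) (f : {ffun K -> G}) : {ffun K * K -> bool} :=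
  [ffun p => f p.1 == f p.2].

Lemma homsP (K : finType) (e : rel K) (G : graph) (f : {ffun K -> G}) :
  reflect (forall x y, e x y -> adj (f x) (f y)) (f \in homs e G).
Proof.
rewrite inE; apply: (iffP forallP) => [H x y|H x].
  by have /forallP/(_ y)/implyP := H x.
by apply/forallP => y; apply/implyP; apply: H.
Qed.

Lemma injsP (K : finType) (e : rel K) (G : graph) (f : {ffun K -> G}) :
  reflect ((forall x y, e x y -> adj (f x) (f y)) /\ injective f) (f \in injs e G).
Proof.
rewrite inE; apply: (iffP andP) => -[].
  by move=> /homsP ? /injectiveP ?.
by move=> ? ?; split; [apply/homsP|apply/injectiveP].
Qed.

Lemma injsE (K : finType) (e : rel K) (G : graph) :
  injs e G = [set f in homs e G | kernel f == [ffun p => p.1 == p.2]].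
Proof.
apply/setP => f; rewrite !inE; congr (_ && _); apply/injectiveP/eqP => [f_inj|kf x y fxy].
  by apply/ffunP => p; rewrite !ffunE; apply: (inj_eq f_inj).
by have /ffunP/(_ (x, y)) := kf; rewrite !ffunE /= fxy eqxx => /esym/eqP.
Qed.

Section Image.
Variables (K : finType) (e : rel K) (G : graph) (f0 : {ffun K -> G}).

(** The quotient of [K] by the kernel of [f0], realized inside [G]: when [f0] is a homomorphism, it
    is a subgraph of [G] and inherits a grid model. *)
Definition image_type : finType := {a : G | a \in codom f0}.
Definition to_image (x : K) : image_type := exist _ (f0 x) (codom_f f0 x).
Definition image_rel : rel image_type :=
  [rel a b | [exists x, exists y, [&& e x y, to_image x == a & to_image y == b]]].

Lemma to_image_surj a : exists x, to_image x == a.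
Proof.
by case: a => a ha; have /codomP[x ax] := ha; exists x; apply/eqP/val_inj.
Qed.

Lemma to_image_eq x y : (to_image x == to_image y) = (f0 x == f0 y).
Proof. by []. Qed.

Lemma image_rel_sym : symmetric e -> symmetric image_rel.
Proof.
move=> e_sym a b; apply/existsP/existsP => -[x /existsP[y /and3P[exy xa yb]]];
  by exists y; apply/existsP; exists x; rewrite e_sym exy xa yb.
Qed.

Lemma grid_minor_image_rel : f0 \in homs e G -> grid_minor (@adj G) -> grid_minor image_rel.
Proof.
move=> /homsP f0_hom; apply: (grid_minor_sub val_inj) => a b.
by case/existsP => x /existsP[y /and3P[exy /eqP<- /eqP<-]]; apply: f0_hom.
Qed.

Lemma card_homs_kernel (L : graph) :
  #|[set f in homs e L | kernel f == kernel f0]| = #|injs image_rel L|.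
Proof.
pose pull (g : {ffun image_type -> L}) : {ffun K -> L} := [ffun x => g (to_image x)].
have pull_inj : injective pull.
  move=> g g' gg'; apply/ffunP => a; have [x /eqP<-] := to_image_surj a.
  by have /ffunP/(_ x) := gg'; rewrite !ffunE.
rewrite -(card_imset _ pull_inj); apply: eq_card => f.
apply/idP/imsetP => [|[g /injsP[g_hom g_inj] ->]]; last first.
  rewrite inE; apply/andP; split.
    apply/homsP => x y exy; rewrite !ffunE; apply: g_hom.
    by apply/existsP; exists x; apply/existsP; exists y; rewrite exy !eqxx.
  by apply/eqP/ffunP => p; rewrite !ffunE (inj_eq g_inj).
rewrite inE => /andP[/homsP f_hom /eqP kf].
have f0f x y : (f x == f y) = (f0 x == f0 y).
  by have /ffunP/(_ (x, y)) := kf; rewrite !ffunE.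
pose g : {ffun image_type -> L} := [ffun a => f (xchoose (to_image_surj a))].
have gE x : g (to_image x) = f x.
  rewrite ffunE; apply/eqP; rewrite f0f -to_image_eq.
  exact: (xchooseP (to_image_surj (to_image x))).
exists g; last by apply/ffunP => x; rewrite ffunE gE.
apply/injsP; split.
  by move=> a b /existsP[x /existsP[y /and3P[exy /eqP<- /eqP<-]]]; rewrite !gE; apply: f_hom.
move=> a b; have [x /eqP<-] := to_image_surj a; have [y /eqP<-] := to_image_surj b.
by rewrite !gE => /eqP; rewrite f0f -to_image_eq => /eqP.
Qed.

Lemma card_image_type : kernel f0 != [ffun p => p.1 == p.2] -> #|image_type| < #|K|.
Proof.
rewrite card_sig => h.
have -> : #|[pred a | a \in codom f0]| = #|codom f0| by apply: eq_card.
rewrite ltn_neqAle leq_image_card andbT; apply: contraNneq h => /eqP/image_injP f0_inj.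
by apply/eqP/ffunP => p; rewrite !ffunE; apply/eqP/eqP => [/f0_inj->//|->].
Qed.
End Image.

Section Lovasz.
Variables G H : graph.
Hypotheses (minorG : grid_minor (@adj G)) (minorH : grid_minor (@adj H)).
Hypothesis eq_homs : forall (K : finType) (e : rel K),
  symmetric e -> grid_minor e -> #|homs e G| = #|homs e H|.

(** Strong induction on the size of [K]. Split the homomorphisms by kernel: the trivial kernel gives
    the embeddings, any other the embeddings of a strictly smaller quotient. A kernel realized in
    [G] or [H] has a quotient that is a subgraph of it, hence a grid minor; one realized in neither
    contributes 0 to both sides. *)
Lemma eq_injs (K : finType) (e : rel K) :
  symmetric e -> grid_minor e -> #|injs e G| = #|injs e H|.
Proof.
have [N] := ubnP #|K|; elim: N K e => // N IH K e KN e_sym e_minor.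
have split_homs (L : graph) : #|homs e L| = #|injs e L| +
    \sum_(k | k != [ffun p => p.1 == p.2]) #|[set f in homs e L | kernel f == k]|.
  rewrite -sum1_card (partition_big (@kernel K L) predT)//= injsE.
  rewrite (bigD1 [ffun p => p.1 == p.2])//= sum1_card; congr (_ + _).
    by apply: eq_card => f; rewrite [RHS]inE.
  by apply: eq_bigr => k _; rewrite sum1_card; apply: eq_card => f; rewrite [RHS]inE.
have := eq_homs e_sym e_minor; rewrite !split_homs.
have -> : \sum_(k | k != [ffun p => p.1 == p.2]) #|[set f in homs e G | kernel f == k]| =
    \sum_(k | k != [ffun p => p.1 == p.2]) #|[set f in homs e H | kernel f == k]|.
  apply: eq_bigr => k k_neq.
  have key (L : graph) (f : {ffun K -> L}) : grid_minor (@adj L) -> f \in homs e L ->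
      kernel f = k -> #|[set f in homs e G | kernel f == k]| = #|[set f in homs e H | kernel f == k]|.
    move=> minorL f_hom fk; rewrite -fk !card_homs_kernel.
    apply: IH; last exact: grid_minor_image_rel.
      by apply: leq_trans (card_image_type _) _; rewrite ?fk.
    exact: image_rel_sym.
  have [G0|[f]] := set_0Vmem [set f in homs e G | kernel f == k]; last first.
    by rewrite inE => /andP[fG /eqP]; apply: key.
  have [H0|[f]] := set_0Vmem [set f in homs e H | kernel f == k]; last first.
    by rewrite inE => /andP[fH /eqP]; apply: key.
  by rewrite G0 H0 !cards0.
by move/addIn.
Qed.

Lemma injs_id_gt0 (L : graph) : 0 < #|injs (@adj L) L|.
Proof.
apply/card_gt0P; exists [ffun x => x]; by apply/injsP; split=> x y; rewrite !ffunE.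
Qed.

Lemma injs_gt0P (K L : graph) : 0 < #|injs (@adj K) L| ->
  exists2 f : K -> L, injective f & forall x y, adj x y -> adj (f x) (f y).
Proof. by case/card_gt0P => f /injsP[? ?]; exists f. Qed.

Definition arcs (L : graph) := [set p : L * L | adj p.1 p.2].

Lemma leq_card_arcs (K L : graph) (f : K -> L) :
  injective f -> (forall x y, adj x y -> adj (f x) (f y)) -> #|arcs K| <= #|arcs L|.
Proof.
move=> f_inj f_hom; pose ff (p : K * K) := (f p.1, f p.2).
rewrite -(card_imset _ (f := ff)); last by move=> [x y] [x' y'] [/f_inj-> /f_inj->].
by apply/subset_leq_card/fintype.subsetP => p /imsetP[q /[!inE] /f_hom ? ->].
Qed.

Theorem grid_minor_isomorphic : graph_isomorphic G H.
Proof.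
have [f f_inj f_hom] : exists2 f : G -> H, injective f & forall x y, adj x y -> adj (f x) (f y).
  by apply: injs_gt0P; rewrite -(eq_injs (@adj_sym G) minorG) injs_id_gt0.
have [g g_inj g_hom] : exists2 g : H -> G, injective g & forall x y, adj x y -> adj (g x) (g y).
  by apply: injs_gt0P; rewrite (eq_injs (@adj_sym H) minorH) injs_id_gt0.
exists f; first by apply: inj_card_bij => //; apply: leq_card g_inj.
move=> x y; apply/idP/idP; last exact: f_hom.
pose ff (p : G * G) := (f p.1, f p.2) => fxy.
have ff_inj : injective ff by move=> [a b] [a' b'] [/f_inj-> /f_inj->].
(* Embeddings both ways bound the numbers of arcs both ways, so [f] maps arcs onto arcs and reflects
   adjacency. *)
have ffE : ff @: arcs G = arcs H.
  apply/eqP; rewrite eqEcard card_imset// (leq_card_arcs g_inj g_hom) andbT.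
  by apply/fintype.subsetP => p /imsetP[q /[!inE] /f_hom ? ->].
have : ff (x, y) \in ff @: arcs G by rewrite ffE inE.
by rewrite (mem_imset _ _ ff_inj) inE.
Qed.
End Lovasz.

(** * Planar graphs are grid minors *)

Section Routing.
Variables (K : finType) (e : rel K) (m n L : nat).
(** [w x y] follows the arc from [x] towards [y] over its first two thirds, the first third ending
    at step [L]. Walks may pause. *)
Variables (w : K -> K -> nat -> 'I_m.+1 * 'I_n) (c : K -> 'I_m.+1 * 'I_n).
Hypotheses (e_sym : symmetric e) (e_irr : irreflexive e).
Hypothesis w_start : forall x y, w x y 0 = c x.
Hypothesis w_step : forall x y j, j < L + L ->
  w x y j = w x y j.+1 \/ grid_adj (w x y j) (w x y j.+1).
Hypothesis w_meet : forall x y, e x y -> w x y (L + L) = w y x L.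
Hypothesis w_near_near : forall x x' y y' j j',
  x != x' -> j <= L -> j' <= L -> w x y j <> w x' y' j'.
Hypothesis w_edge_near : forall x y x' y' j j',
  e x y -> x' != x -> x' != y -> j <= L + L -> j' <= L -> w x y j <> w x' y' j'.
Hypothesis w_mid_mid : forall x y x' y' j j',
  e x y -> e x' y' -> (x', y') <> (x, y) -> (x', y') <> (y, x) ->
  L <= j <= L + L -> L <= j' <= L + L -> w x y j <> w x' y' j'.

(** [near x] collects the first thirds of the walks from [x]. The order [before] chooses the end of
    an edge whose branch set is extended along the walk, stopping just short of [hit], the first
    entry into the near set of the other end. *)
Let near (x : K) (u : 'I_m.+1 * 'I_n) := [exists y, exists j : 'I_L.+1, w x y j == u].
Let hit x y := find (fun i => near y (w x y i)) (iota 0 (L + L).+1).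
Let before (x y : K) : bool := enum_rank x < enum_rank y.
Let branch (x : K) (u : 'I_m.+1 * 'I_n) := near x u || [exists y,
  [&& e x y, before x y & [exists j : 'I_(L + L).+1, (j < hit x y) && (w x y j == u)]]].

Let nearP x u : reflect (exists y j, j <= L /\ w x y j = u) (near x u).
Proof.
apply: (iffP existsP) => [[y /existsP[j /eqP ju]]|[y [j [jL ju]]]].
  by exists y, j; split=> //; rewrite -ltnS.
by exists y; apply/existsP; exists (Ordinal (jL : j < L.+1)); apply/eqP.
Qed.

Let has_hit x y : e x y -> has (fun i => near y (w x y i)) (iota 0 (L + L).+1).
Proof.
move=> exy; apply/hasP; exists (L + L); first by rewrite mem_iota /= add0n.
by apply/nearP; exists x, L; split=> //; rewrite w_meet.
Qed.

Let hit_le x y : e x y -> hit x y <= L + L.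
Proof. by move=> /has_hit; rewrite has_find size_iota ltnS. Qed.

Let near_hit x y : e x y -> near y (w x y (hit x y)).
Proof.
move=> exy; have := nth_find 0 (has_hit exy).
by rewrite nth_iota ?add0n // ltnS; apply: hit_le.
Qed.

Let not_near_before_hit x y j : e x y -> j < hit x y -> ~~ near y (w x y j).
Proof.
move=> exy j_hit; have := before_find 0 j_hit.
rewrite nth_iota ?add0n ?ltnS => [->//|].
exact: leq_trans (ltnW j_hit) (hit_le exy).
Qed.

Let near_uniq x x' u : near x u -> near x' u -> x = x'.
Proof.
move=> /nearP[y [j [jL <-]]] /nearP[y' [j' [jL' E]]].
by apply/eqP; apply: contraPT E => xx' /esym; apply: w_near_near.
Qed.

Let branchP x u : reflect (near x u \/ exists y j,
  [/\ e x y, before x y, L < j, j < hit x y & w x y j = u]) (branch x u).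
Proof.
apply: (iffP orP) => -[].
- by left.
- case/existsP => y /and3P[exy xy /existsP[j /andP[jh /eqP ju]]].
  have [jL|jL] := leqP j L; first by left; apply/nearP; exists y, j.
  by right; exists y, j.
- by left.
- case=> y [j [exy xy jL jh ju]]; right; apply/existsP; exists y; rewrite exy xy /=.
  have jLL : j < (L + L).+1 by rewrite ltnS ltnW// (leq_trans jh)// hit_le.
  by apply/existsP; exists (Ordinal jLL); rewrite jh; apply/eqP.
Qed.

(** A point added to the branch set of [x'] along the edge to [y] is near no third vertex by
    separation, nor near [y] since it precedes [hit]. *)
Let near_branch_uniq x x' u : near x u -> branch x' u -> x = x'.
Proof.
move=> xu /branchP[/(near_uniq xu)//|[y [j [exy _ _ jh ju]]]].
have [//|xx'] := eqVneq x x'.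
have [xy|xy] := eqVneq x y.
  by have := not_near_before_hit exy jh; rewrite ju -xy xu.
case/nearP: xu => y' [j' [jL' E]].
have jLL : j <= L + L by rewrite ltnW// (leq_trans jh)// hit_le.
by case: (w_edge_near (y' := y') exy xx' xy jLL jL'); rewrite E.
Qed.

(** Middle parts of distinct edges are disjoint by hypothesis, and [before] prevents both ends of
    one edge from extending along it. *)
Let branch_uniq x x' u : branch x u -> branch x' u -> x = x'.
Proof.
move=> xu x'u; case/branchP: (xu) => [/near_branch_uniq|[y [j [exy xy jL jh ju]]]].
  exact.
case/branchP: x'u => [/near_branch_uniq/(_ xu)->//|[y' [j' [exy' xy' jL' jh' ju']]]].
have [//|xx'] := eqVneq x x'.
have jLL : L <= j <= L + L by rewrite ltnW//= ltnW// (leq_trans jh)// hit_le.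
have jLL' : L <= j' <= L + L by rewrite ltnW//= ltnW// (leq_trans jh')// hit_le.
case: (w_mid_mid exy exy' _ _ jLL jLL'); last by rewrite ju ju'.
  by case=> E _; rewrite E eqxx in xx'.
by case=> E1 E2; move: xy xy'; rewrite E1 E2 /before => /ltnW; rewrite leqNgt => /negbTE->.
Qed.

Let beta u := [pick x | branch x u].

Let betaP u x : (beta u == Some x) = branch x u.
Proof.
rewrite /beta; case: pickP => [y yu|->//].
by apply/eqP/idP => [[<-]//|/(branch_uniq yu)->].
Qed.

Let near_start x : near x (c x).
Proof. by apply/nearP; exists x, 0. Qed.

Let connect_walk x y J : (forall j, j <= J -> branch x (w x y j)) -> J <= L + L ->
  connect (fun v v' => grid_adj v v' && (beta v == beta v')) (c x) (w x y J).
Proof.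
elim: J => [|J IH] walk JL; first by rewrite w_start.
apply: connect_trans (IH _ (ltnW JL)) _ => [j jJ|]; first by apply: walk; apply: leqW.
have [->//|vv'] := w_step x y JL.
apply: connect1; rewrite vv' /=.
have /eqP-> : beta (w x y J) == Some x by rewrite betaP walk.
by rewrite eq_sym betaP walk.
Qed.

(** The last point before [hit] is in the branch set of [x], the next one is near [y], and they
    differ, so the walk makes a true grid step between them. *)
Let edge_before x y : e x y -> before x y -> exists u v,
  [/\ grid_adj u v, beta u = Some x & beta v = Some y].
Proof.
move=> exy xy; have h_near := near_hit exy; have h_le := hit_le exy.
have not_near j : j < hit x y -> ~~ near y (w x y j) by apply: not_near_before_hit.
case hE: (hit x y) h_near h_le not_near => [|h] h_near h_le not_near.
  have := near_uniq h_near; rewrite w_start => /(_ _ (near_start x)) yx.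
  by move: exy; rewrite yx e_irr.
exists (w x y h), (w x y h.+1); split.
- have [E|//] := w_step x y h_le.
  by have := not_near h (leqnn _); rewrite E h_near.
- apply/eqP; rewrite betaP; apply/orP; right; apply/existsP; exists y.
  rewrite exy xy; apply/existsP; exists (Ordinal (leqW h_le : h < (L + L).+1)).
  by rewrite /= hE ltnS leqnn eqxx.
- by apply/eqP; rewrite betaP /branch h_near.
Qed.

Lemma grid_minor_of_walks : grid_minor e.
Proof.
exists m, n, beta, c; split=> [x|u x /eqP|x y exy].
- by apply/eqP; rewrite betaP /branch near_start.
- rewrite betaP => /branchP[/nearP[y [j [jL <-]]]|[y [j [exy xy jL jh <-]]]].
    apply: connect_walk; last exact: leq_trans jL (leq_addr _ _).
    move=> j' j'j; apply/branchP; left; apply/nearP; exists y, j'.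
    by rewrite (leq_trans j'j).
  have jLL : j <= L + L by rewrite ltnW// (leq_trans jh)// hit_le.
  apply: connect_walk => // j' j'j; apply/orP; right; apply/existsP; exists y.
  rewrite exy xy /=; apply/existsP; exists (Ordinal (leq_trans j'j jLL : j' < (L + L).+1)).
  by rewrite /= eqxx (leq_ltn_trans j'j jh).
- have [xy|] := boolP (before x y); first exact: edge_before.
  rewrite /before -leqNgt leq_eqVlt => /orP[/eqP/ord_inj/enum_rank_inj yx|yx].
    by move: exy; rewrite yx e_irr.
  have [|u [v [uv bu bv]]] := @edge_before y x _ yx; first by rewrite e_sym.
  by exists v, u; split=> //; rewrite /grid_adj orbC.
Qed.
End Routing.

(** * Separation and uniform continuity on compact sets *)

Local Open Scope classical_set_scope.
Local Open Scope ring_scope.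

(** Each point of [A] has a ball free of [B], and compactness makes the radius uniform. Stating this
    for all small [d] lets finitely many such bounds be combined by intersecting filters. *)
Lemma compact_separated (R : realType) (T : pseudoMetricType R) (A B : set T) :
  compact A -> closed B -> A `&` B = set0 ->
  \forall d \near 0^'+, forall a b, A a -> B b -> ~ ball a d b.
Proof.
move=> /compact_near_coveringP cptA clB AB0.
apply: (@filterS _ _ _ (fun d => A `<=` fun a => forall b, B b -> ~ ball a d b)).
  by move=> d H a b Aa; apply: H.
apply: (cptA _ (0 : R)^'+ (fun d a => forall b, B b -> ~ ball a d b) _ _) => a Aa.
have /nbhs_ballP[r /= r0 ar] : nbhs a (~` B).
  apply: open_nbhs_nbhs; split; first exact: closed_openC.
  by move=> Ba; have : (A `&` B) a by []; rewrite AB0.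
exists (ball a (r / 2), [set d | d < r / 2]); first split => /=.
- by apply: nbhsx_ballx; rewrite divr_gt0.
- by apply: nbhs_right_lt; rewrite divr_gt0.
move=> [a' d] /= [aa' dr] b Bb a'b; apply: (ar b) => //.
by apply: ball_split aa' _; apply: le_ball a'b; apply: ltW.
Qed.

Lemma uniform_on_segment (R : realType) (T : pseudoMetricType R) (f : R -> T) :
  {within `[0, 1], continuous f} -> forall r, 0 < r ->
  \forall d \near 0^'+, forall s t, s \in `[0, 1] -> t \in `[0, 1] -> `|s - t| < d ->
    ball (f s) r (f t).
Proof.
move=> /subspace_continuousP f_cont r r0.
have /compact_near_coveringP cpt := @segment_compact R 0 1.
apply: (@filterS _ _ _ (fun d => `[0, 1] `<=` fun s => forall t, s \in `[0, 1] ->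
    t \in `[0, 1] -> `|s - t| < d -> ball (f s) r (f t))).
  by move=> d H s t s01; apply: H.
apply: (cpt _ (0 : R)^'+ (fun d s => forall t, s \in `[0, 1] ->
    t \in `[0, 1] -> `|s - t| < d -> ball (f s) r (f t)) _ _) => s s01.
have /nbhs_ballP[e /= e0 se] : nbhs s (fun t => t \in `[0, 1] -> ball (f s) (r / 2) (f t)).
  by have := f_cont s s01; apply; apply: nbhsx_ballx; rewrite divr_gt0.
exists (ball s (e / 2), [set d | d < e / 2]); first split => /=.
- by apply: nbhsx_ballx; rewrite divr_gt0.
- by apply: nbhs_right_lt; rewrite divr_gt0.
move=> [s' d] /= [ss' de] t s'01 t01 s't.
have e2 : e / 2 <= e by lra.
apply: (ball_splitr (z := f s)).
  by apply: se => //; apply: le_ball ss'.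
apply: se => //; apply: ball_split ss' _; apply: le_ball (ltW de) _ _.
exact: s't.
Qed.

Lemma truncn_eq_dist (R : realType) (a b : R) : 0 <= a -> 0 <= b ->
  Num.truncn a = Num.truncn b -> `|a - b| < 1.
Proof.
move=> /truncn_itv/andP[a1 a2] /truncn_itv/andP[b1 b2] ab.
rewrite ab in a1 a2; rewrite -natr1 in a2; rewrite -natr1 in b2.
by rewrite ltr_norml; apply/andP; split; lra.
Qed.

Lemma truncn_dist1 (R : realType) (a b : R) : 0 <= a -> 0 <= b -> `|a - b| < 1 ->
  [\/ Num.truncn a = Num.truncn b, Num.truncn a = (Num.truncn b).+1
    | Num.truncn b = (Num.truncn a).+1].
Proof.
move=> /truncn_itv/andP[a1 a2] /truncn_itv/andP[b1 b2]; rewrite ltr_norml => /andP[ab ba].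
have h1 : (Num.truncn a < (Num.truncn b).+2)%N.
  by rewrite -(ltr_nat R) -natr1; rewrite -natr1 in b2; lra.
have h2 : (Num.truncn b < (Num.truncn a).+2)%N.
  by rewrite -(ltr_nat R) -natr1; rewrite -natr1 in a2; lra.
have [?|[?|?]] : Num.truncn a = Num.truncn b \/ Num.truncn a = (Num.truncn b).+1
    \/ Num.truncn b = (Num.truncn a).+1 by lia.
- by constructor 1.
- by constructor 2.
- by constructor 3.
Qed.

(** * Discretization of a drawing on a fine grid *)

Section Drawing.
Variables (R : realType) (K : finType) (e : rel K).
Variables (p : K -> R * R) (g : K -> K -> R -> R * R).
Hypotheses (e_sym : symmetric e) (e_irr : irreflexive e).
Hypothesis g_cont : forall x y, {within `[0, 1], continuous (g x y)}.
Hypothesis g0 : forall x y, g x y 0 = p x.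
Hypothesis g_rev : forall x y (t : R), e x y -> t \in `[0, 1] -> g y x t = g x y (1 - t).
Hypothesis g_near_near : forall x y x' y' (s t : R),
  x != x' -> s \in `[0, 3^-1] -> t \in `[0, 3^-1] -> g x y s <> g x' y' t.
Hypothesis g_edge_near : forall x y x' y' (s t : R),
  e x y -> x' != x -> x' != y -> s \in `[0, 1] -> t \in `[0, 3^-1] -> g x y s <> g x' y' t.
Hypothesis g_mid_mid : forall x y x' y' (s t : R),
  e x y -> e x' y' -> (x', y') <> (x, y) -> (x', y') <> (y, x) ->
  s \in `[3^-1, 2 / 3] -> t \in `[3^-1, 2 / 3] -> g x y s <> g x' y' t.

Let separated (x y x' y' : K) (a b a' b' : R) : 0 <= a -> b <= 1 -> 0 <= a' -> b' <= 1 ->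
  (forall s t, s \in `[a, b] -> t \in `[a', b'] -> g x y s <> g x' y' t) ->
  \forall d \near 0^'+, forall s t, s \in `[a, b] -> t \in `[a', b'] ->
    ~ ball (g x y s) d (g x' y' t).
Proof.
move=> a0 b1 a0' b1' disj.
have cpt u v (c c' : R) : 0 <= c -> c' <= 1 -> compact (g u v @` `[c, c']).
  move=> c0 c1; apply: continuous_compact; last exact: segment_compact.
  have := @continuous_subspaceW _ _ `[c, c'] `[0, 1] (g u v) _ (@g_cont u v).
  apply=> t /=; rewrite !in_itv /= => /andP[? ?].
  by apply/andP; split; lra.
have clB : closed (g x' y' @` `[a', b']).
  by apply: compact_closed (cpt _ _ _ _ a0' b1'); exact: norm_hausdorff.
apply: filterS (compact_separated (cpt x y a b a0 b1) clB _).
  by move=> d H s t sab tab; apply: H; [exists s|exists t].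
rewrite -subset0 => z [[s sab <-] [t tab]] /esym.
exact: disj.
Qed.

Let all_separated : exists2 d : R, 0 < d & [/\
  forall x y x' y' (s t : R), x != x' -> s \in `[0, 3^-1] -> t \in `[0, 3^-1] ->
    ~ ball (g x y s) d (g x' y' t),
  forall x y x' y' (s t : R), e x y -> x' != x -> x' != y ->
    s \in `[0, 1] -> t \in `[0, 3^-1] -> ~ ball (g x y s) d (g x' y' t)
& forall x y x' y' (s t : R), e x y -> e x' y' -> (x', y') <> (x, y) -> (x', y') <> (y, x) ->
    s \in `[3^-1, 2 / 3] -> t \in `[3^-1, 2 / 3] -> ~ ball (g x y s) d (g x' y' t)].
Proof.
(* The hypothesis [P] does not depend on [d], so it moves inside the filter; if it is false, every
   [d] will do. *)
have guard (P : Prop) (Q : R -> Prop) :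
    (P -> \forall d \near 0^'+, Q d) -> \forall d \near 0^'+, P -> Q d.
  move=> PQ; have [h|nP] := pselect P; last by apply: nearW.
  by apply: filterS (PQ h).
pose sep x y x' y' (a b a' b' d : R) := forall s t : R, s \in `[a, b] -> t \in `[a', b'] ->
  ~ ball (g x y s) d (g x' y' t).
have n1 : \forall d \near 0^'+, forall x y x' y', x != x' -> sep x y x' y' 0 3^-1 0 3^-1 d.
  do 4!apply: filter_forall => ?; apply: guard => xx'.
  by apply: separated => [||||s t]; rewrite ?invf_le1 ?ler1n//; apply: g_near_near.
have n2 : \forall d \near 0^'+, forall x y x' y', [/\ e x y, x' != x & x' != y] ->
    sep x y x' y' 0 1 0 3^-1 d.
  do 4!apply: filter_forall => ?; apply: guard => -[exy xx' xy'].
  by apply: separated => [||||s t]; rewrite ?invf_le1 ?ler1n//; apply: g_edge_near.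
have n3 : \forall d \near 0^'+, forall x y x' y',
    [/\ e x y, e x' y', (x', y') <> (x, y) & (x', y') <> (y, x)] ->
    sep x y x' y' 3^-1 (2 / 3) 3^-1 (2 / 3) d.
  do 4!apply: filter_forall => ?; apply: guard => -[exy exy' xx' xy'].
  have h : 2 / 3 <= 1 :> R by lra.
  by apply: separated => [||||s t]; rewrite ?invr_ge0//; apply: g_mid_mid.
have [d [[[d0 h1] h2] h3]] := filter_ex (filterI (filterI (filterI (nbhs_right_gt 0) n1) n2) n3).
exists d => //; split=> x y x' y' s t.
- by move=> xx'; apply: h1.
- by move=> exy xx' xy'; apply: h2.
- by move=> exy exy' xx' xy'; apply: h3.
Qed.

Theorem grid_minor_of_drawing : grid_minor e.
Proof.
have [d d0 [sep_nn sep_en sep_mm]] := all_separated.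
(* A shared cell puts first coordinates within [h]. Second coordinates are sampled up to one time
   step earlier, which costs one more [h] on each of the two walks: 3h in total. *)
pose h := d / 3; have h0 : 0 < h by rewrite divr_gt0.
have [eta [eta0 unif]] : exists eta : R, 0 < eta /\ forall x y (s t : R),
    s \in `[0, 1] -> t \in `[0, 1] -> `|s - t| < eta -> ball (g x y s) h (g x y t).
  suff near_eta : \forall r \near 0^'+, forall x y (s t : R),
      s \in `[0, 1] -> t \in `[0, 1] -> `|s - t| < r -> ball (g x y s) h (g x y t).
    by have [r [r0 rP]] := filter_ex (filterI (nbhs_right_gt 0) near_eta); exists r.
  by do 2!apply: filter_forall => ?; apply: uniform_on_segment.
(* [N] exceeds 1/eta, so samples 1/(3N) apart move each coordinate by less than [h]; the factor 3
   puts the thirds of an arc at samples [N] and 2N. *)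
pose N := (Num.truncn eta^-1).+1.
have N0 : 0 < N%:R :> R by rewrite ltr0n.
pose time (j : nat) : R := j%:R / (3 * N%:R).
have time_le (j k : nat) (r : R) : k%:R = r * (3 * N%:R) -> (j <= k)%N -> time j <= r.
  by move=> kE jk; rewrite ler_pdivrMr ?mulr_gt0// -kE ler_nat.
have time_ge (j k : nat) (r : R) : k%:R = r * (3 * N%:R) -> (k <= j)%N -> r <= time j.
  by move=> kE jk; rewrite ler_pdivlMr ?mulr_gt0// -kE ler_nat.
have time0 j : 0 <= time j by rewrite divr_ge0 ?mulr_ge0 ?ler0n.
have N13 : N%:R = 3^-1 * (3 * N%:R) :> R by rewrite mulKf ?pnatr_eq0.
have N23 : (2 * N)%N%:R = 2 / 3 * (3 * N%:R) :> R by rewrite natrM; field.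
have N33 : (3 * N)%N%:R = 1 * (3 * N%:R) :> R by rewrite natrM mul1r.
have in01 j : (j <= 3 * N)%N -> time j \in `[0, 1].
  by move=> jN; rewrite in_itv /= time0 (time_le _ _ _ N33).
have in_near j : (j <= N)%N -> time j \in `[0, 3^-1].
  by move=> jN; rewrite in_itv /= time0 (time_le _ _ _ N13).
have in_mid j : (N <= j <= 2 * N)%N -> time j \in `[3^-1, 2 / 3].
  by case/andP=> Nj jN; rewrite in_itv /= (time_ge _ _ _ N13)// (time_le _ _ _ N23).
have timeS j k : (k = j \/ k = j.+1) -> `|time k - time j| < eta.
  have N_eta : (3 * N%:R)^-1 < eta.
    rewrite -[ltRHS]invrK ltf_pV2 ?posrE ?mulr_gt0 ?invr_gt0//.
    have /truncn_itv/andP[_] : 0 <= eta^-1 by rewrite invr_ge0 ltW.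
    by rewrite -/N => ?; lra.
  case=> ->; first by rewrite subrr normr0.
  rewrite /time -natr1 mulrDl mul1r addrAC subrr add0r gtr0_norm//.
  by rewrite invr_gt0 mulr_gt0.
pose X x y j := (g x y (time j)).1; pose Y x y j := (g x y (time j)).2.
have XS x y j k : (k = j \/ k = j.+1) -> (k <= 3 * N)%N -> `|X x y k - X x y j| < h.
  move=> jk kN; have [] // := unif x y (time k) (time j) (in01 _ kN) (in01 _ _) (timeS _ _ jk).
  by case: jk kN => -> // /ltnW.
have YS x y j k : (k = j \/ k = j.+1) -> (k <= 3 * N)%N -> `|Y x y k - Y x y j| < h.
  move=> jk kN; have [] // := unif x y (time k) (time j) (in01 _ kN) (in01 _ _) (timeS _ _ jk).
  by case: jk kN => -> // /ltnW.
(* A crude common bound for the finitely many sampled coordinates, so that they fit in a finite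
   grid. *)
pose M : R := \sum_(q : K * K * 'I_(3 * N).+1) (`|X q.1.1 q.1.2 q.2| + `|Y q.1.1 q.1.2 q.2|).
have M_ge x y j : (j <= 3 * N)%N -> `|X x y j| + `|Y x y j| <= M.
  move=> jN; rewrite /M (bigD1 (x, y, Ordinal (jN : (j < (3 * N).+1)%N)))//= lerDl.
  by apply: sumr_ge0 => *; rewrite addr_ge0.
have X_le x y j : (j <= 3 * N)%N -> `|X x y j| <= M.
  by move=> jN; apply: le_trans (M_ge x y j jN); rewrite lerDl.
have Y_le x y j : (j <= 3 * N)%N -> `|Y x y j| <= M.
  by move=> jN; apply: le_trans (M_ge x y j jN); rewrite lerDr.
pose B := Num.truncn ((M + M) / h).
pose cell (z : R) : 'I_B.+1 := inord (Num.truncn ((z + M) / h)).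
have shift_ge0 z : `|z| <= M -> 0 <= (z + M) / h.
  by rewrite ler_norml => /andP[? ?]; rewrite divr_ge0 ?(ltW h0)//; lra.
have cellE z : `|z| <= M -> cell z = Num.truncn ((z + M) / h) :> nat.
  rewrite ler_norml => /andP[_ zM]; rewrite inordK// ltnS; apply: le_truncn.
  by rewrite ler_pM2r ?invr_gt0// lerD2r.
have shiftB z z' : (z + M) / h - (z' + M) / h = (z - z') / h.
  by rewrite -mulrBl opprD addrACA subrr addr0.
have normh z : `|z / h| = `|z| / h by rewrite normrM normfV (gtr0_norm h0).
have cell_eq z z' : `|z| <= M -> `|z'| <= M -> cell z = cell z' -> `|z - z'| < h.
  move=> zM zM' /(congr1 (@nat_of_ord _)); rewrite !cellE// => /truncn_eq_dist.
  rewrite shiftB normh ltr_pdivrMr// mul1r; apply; exact: shift_ge0.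
have cell_step z z' : `|z| <= M -> `|z'| <= M -> `|z - z'| < h ->
    [\/ cell z = cell z', cell z = (cell z').+1 :> nat | cell z' = (cell z).+1 :> nat].
  move=> zM zM' zz'; rewrite !cellE//.
  have := truncn_dist1 (shift_ge0 _ zM) (shift_ge0 _ zM').
  rewrite shiftB normh ltr_pdivrMr// mul1r => /(_ zz')[] E; last 2 first.
  - by constructor 2.
  - by constructor 3.
  by constructor 1; apply: ord_inj; rewrite !cellE.
(* Each time step is split into two grid steps: the first coordinate moves when the index becomes
   odd, the second when it becomes even, so no step is diagonal. *)
pose w x y i := (cell (X x y (uphalf i)), cell (Y x y i./2)).
have w_close x y x' y' i i' : (i <= 4 * N)%N -> (i' <= 4 * N)%N -> w x y i = w x' y' i' ->
    ball (g x y (time (uphalf i))) d (g x' y' (time (uphalf i'))).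
  move=> iN iN' [Xe Ye].
  have [u1 u2 u3 u4] : [/\ uphalf i <= 3 * N, uphalf i' <= 3 * N, i./2 <= 3 * N &
    i'./2 <= 3 * N]%N by split; lia.
  have hX := cell_eq _ _ (X_le x y _ u1) (X_le x' y' _ u2) Xe.
  have hY := cell_eq _ _ (Y_le x y _ u3) (Y_le x' y' _ u4) Ye.
  have step (k : nat) : uphalf k = k./2 \/ uphalf k = k./2.+1 by lia.
  have hY1 := YS x y _ _ (step i) u1; have hY2 := YS x' y' _ _ (step i') u2.
  split; rewrite /ball /= -/(X _ _ _) -/(Y _ _ _).
    by apply: lt_trans hX _; rewrite /h; lra.
  have -> : Y x y (uphalf i) - Y x' y' (uphalf i') = (Y x y (uphalf i) - Y x y i./2)
    + (Y x y i./2 - Y x' y' i'./2) - (Y x' y' (uphalf i') - Y x' y' i'./2) by ring.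
  apply: le_lt_trans (ler_normB _ _) _.
  have := ler_normD (Y x y (uphalf i) - Y x y i./2) (Y x y i./2 - Y x' y' i'./2).
  by rewrite /h in hY hY1 hY2 *; lra.
have LL : (2 * N + 2 * N = 4 * N)%N by lia.
apply: (@grid_minor_of_walks K e B B.+1 (2 * N) w (fun x => (cell (p x).1, cell (p x).2))) => //.
- by move=> x y; rewrite /w /X /Y /time mul0r g0.
- move=> x y j; rewrite LL => jN; rewrite /w /= uphalf_half.
  have [u1 u2] : (j./2.+1 <= 3 * N)%N /\ (j./2 <= 3 * N)%N by split; lia.
  case: (odd j) => /=; rewrite ?add0n ?add1n.
    have := cell_step _ _ (Y_le x y _ u1) (Y_le x y _ u2) (YS x y _ _ (or_intror erefl) u1).
    case=> [->|E|E]; first by left.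
    + by right; rewrite /grid_adj /grid_next /= E !eqxx.
    + by right; rewrite /grid_adj /grid_next /= E !eqxx ?orbT.
  have := cell_step _ _ (X_le x y _ u1) (X_le x y _ u2) (XS x y _ _ (or_intror erefl) u1).
  case=> [->|E|E]; first by left.
  + by right; rewrite /grid_adj /grid_next /= E !eqxx ?orbT.
  + by right; rewrite /grid_adj /grid_next /= E !eqxx ?orbT.
(* Step 4N is at two thirds of the arc from [x], step 2N at one third of the arc from [y]: the same
   point. *)
- move=> x y exy; rewrite /w LL.
  have -> : uphalf (4 * N) = (2 * N)%N by lia.
  have -> : (4 * N)./2 = (2 * N)%N by lia.
  have -> : uphalf (2 * N) = N by lia.
  have -> : (2 * N)./2 = N by lia.
  have N3 : (N <= 3 * N)%N by lia.
  rewrite /X /Y (g_rev exy (in01 _ N3)).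
  suff -> : 1 - time N = time (2 * N) by [].
  by rewrite /time natrM; field; rewrite gt_eqF.
- move=> x x' y y' j j' xx' jN jN' E; case: (sep_nn x y x' y' (time (uphalf j)) (time (uphalf j'))). 
  + by [].
  + by apply: in_near; lia.
  + by apply: in_near; lia.
  + by apply: w_close E; lia.
- move=> x y x' y' j j' exy xx' xy' jN jN' E.
  case: (sep_en x y x' y' (time (uphalf j)) (time (uphalf j'))) => //.
  + by apply: in01; lia.
  + by apply: in_near; lia.
  + by apply: w_close E; lia.
- move=> x y x' y' j j' exy exy' xx' xy' jN jN' E.
  case: (sep_mm x y x' y' (time (uphalf j)) (time (uphalf j'))) => //.
  + by apply: in_mid; lia.
  + by apply: in_mid; lia.
  + by apply: w_close E; lia.
Qed.
End Drawing.

(** * Coherent parametrizations of the arcs of a planar drawing *)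

Lemma within_continuous_rev (R : realType) (T : topologicalType) (f : R -> T) :
  {within `[0, 1], continuous f} -> {within `[0, 1], continuous (fun t => f (1 - t))}.
Proof.
have rev01 (t : R) : t \in `[0, 1] -> 1 - t \in `[0, 1].
  by rewrite !in_itv /= => /andP[? ?]; apply/andP; split; lra.
move=> /subspace_continuousP f_cont; apply/subspace_continuousP => t t01 A /(f_cont _ (rev01 t t01)).
rewrite /= !nbhs_simpl /within /= => /nbhs_ballP[r /= r0 rA].
apply/nbhs_ballP; exists r => //= s ts s01; apply: rA => //; last exact: rev01.
rewrite /ball /= opprB addrC addrA subrK distrC.
exact: ts.
Qed.

Theorem planar_grid_minor (R : realType) (G : graph) : planar R G -> grid_minor (@adj G).
Proof.
case=> p [a [p_inj arc aC vertex cross]].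
have {arc}/choice[f fP] : forall q : G * G, exists f : R -> R * R, adj q.1 q.2 ->
    [/\ {within `[0, 1], continuous f}, {in `[0, 1] &, injective f},
        f 0 = p q.1, f 1 = p q.2 & forall t, t \in `[0, 1] -> a q.1 q.2 (f t)].
  move=> [x y] /=; have [xy|_] := boolP (adj x y); last by exists (fun=> p x).
  have [f [f_cont f_inj f0 f1 E]] := arc _ _ xy.
  by exists f; split=> // t t01; rewrite E; exists t.
have rev01 (t : R) : t \in `[0, 1] -> 1 - t \in `[0, 1].
  by rewrite !in_itv /= => /andP[? ?]; apply/andP; split; lra.
have in0 : (0 : R) \in `[0, 1] by rewrite in_itv /= lexx ler01.
have in1 : (1 : R) \in `[0, 1] by rewrite in_itv /= lexx ler01.
have in13 (t : R) : t \in `[0, 3^-1] -> t \in `[0, 1] /\ t != 1.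
  rewrite !in_itv /= => /andP[? ?]; split; first by apply/andP; split; lra.
  by rewrite lt_eqF//; lra.
pose before (x y : G) := (enum_rank x < enum_rank y)%N.
have before_total x y : adj x y -> before y x = ~~ before x y.
  move=> xy; rewrite /before -leqNgt [RHS]leq_eqVlt.
  have [/ord_inj/enum_rank_inj yx|//] := eqVneq (enum_rank y : nat) (enum_rank x).
  by move: xy; rewrite yx adj_irr.
(* The parametrizations chosen for the two orientations of an edge are unrelated, so only that of
   the [before] end is kept, and reversed for the other end. Nonadjacent pairs get the constant path
   at [x]. *)
pose g (x y : G) (t : R) : R * R := if ~~ adj x y then p x else
  if before x y then f (x, y) t else f (y, x) (1 - t).
have g_nadj : forall (x y : G) (t : R), ~~ adj x y -> g x y t = p x.
  by move=> x y t nxy; rewrite /g nxy.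
have g_adj x y : adj x y -> [/\ {within `[0, 1], continuous (g x y)},
    {in `[0, 1] &, injective (g x y)}, g x y 0 = p x, g x y 1 = p y
    & forall t, t \in `[0, 1] -> a x y (g x y t)].
  move=> xy; rewrite /g xy /=; case: ifP => _; first exact: (fP (x, y) xy).
  have yx : adj y x by rewrite adj_sym.
  have [f_cont f_inj f0 f1 fa] := fP (y, x) yx.
  split; rewrite ?subr0 ?subrr //; first exact: within_continuous_rev.
    by move=> s t /rev01 s01 /rev01 t01 /(f_inj _ _ s01 t01)/addrI/oppr_inj.
  by move=> t /rev01/fa; rewrite aC.
have g_rev x y t : adj x y -> t \in `[0, 1] -> g y x t = g x y (1 - t).
  move=> xy _; rewrite /g (adj_sym y) xy /= (before_total x y xy).
  by case: (before x y) => //=; rewrite opprB addrC subrK.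
have g_vertex x y t z : adj x y -> t \in `[0, 1] -> g x y t = p z ->
    (z = x /\ t = 0) \/ (z = y /\ t = 1).
  move=> xy t01 gz; have [_ g_inj g0 g1 ga] := g_adj x y xy.
  have := ga t t01; rewrite gz => /(vertex _ _ _ xy)[] E; [left|right]; split=> //.
    by apply: g_inj => //; rewrite gz g0 E.
  by apply: g_inj => //; rewrite gz g1 E.
have g_cross x y x' y' s t : adj x y -> adj x' y' -> (x', y') <> (x, y) -> (x', y') <> (y, x) ->
    s \in `[0, 1] -> t \in `[0, 1] -> g x y s = g x' y' t ->
    exists z, g x y s = p z /\ g x' y' t = p z.
  move=> xy xy' n1 n2 s01 t01 st.
  have [_ _ _ _ ga] := g_adj x y xy; have [_ _ _ _ ga'] := g_adj x' y' xy'.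
  have [|z _ pz] := cross x y x' y' xy xy' n1 n2 (g x y s).
    by split; [apply: ga|rewrite st; apply: ga'].
  by exists z; rewrite -st pz.
apply: (@grid_minor_of_drawing R G (@adj G) p g) => //.
- exact: adj_sym.
- exact: adj_irr.
- move=> x y; have [/g_adj[]//|nxy] := boolP (adj x y).
  have -> : g x y = fun=> p x by apply/funext => t; apply: g_nadj.
  by apply: continuous_subspaceT => t; apply: cvg_cst.
- by move=> x y; have [/g_adj[]//|/g_nadj] := boolP (adj x y).
- move=> x y x' y' s t xx' s13 t13; have [s01 s1] := in13 s s13; have [t01 t1] := in13 t t13.
  have [xy|nxy] := boolP (adj x y); have [xy'|nxy'] := boolP (adj x' y') => st.
  (* On one edge seen from both ends, injectivity forces s = 1 - t, impossible for two parameters at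
     most 1/3. Distinct edges meet at a vertex, which a first third contains only as its starting
     point. *)
  + have [[E1 E2]|n2] := pselect ((x', y') = (y, x)).
      have [_ g_inj _ _ _] := g_adj x y xy.
      move: st; rewrite E1 E2 (g_rev x y)// => /(g_inj _ _ s01 (rev01 _ t01)) st.
      by move: s13 t13; rewrite st !in_itv /= => /andP[_ ?] /andP[_ ?]; clear E1 E2; lra.
    have n1 : (x', y') <> (x, y) by case=> E _; rewrite E eqxx in xx'.
    have [z [sz tz]] := g_cross _ _ _ _ _ _ xy xy' n1 n2 s01 t01 st.
    have [[zx _]|[_ E]] := g_vertex _ _ _ _ xy s01 sz; last by rewrite E eqxx in s1.
    have [[zx' _]|[_ E]] := g_vertex _ _ _ _ xy' t01 tz; last by rewrite E eqxx in t1.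
    by rewrite -zx -zx' eqxx in xx'.
  + move: st; rewrite (g_nadj x')// => /(g_vertex _ _ _ _ xy s01)[[E _]|[_ E]].
      by rewrite E eqxx in xx'.
    by rewrite E eqxx in s1.
  + move: st; rewrite (g_nadj x)// => /esym/(g_vertex _ _ _ _ xy' t01)[[E _]|[_ E]].
      by rewrite E eqxx in xx'.
    by rewrite E eqxx in t1.
  + by move: st; rewrite !g_nadj// => /p_inj E; rewrite E eqxx in xx'.
- move=> x y x' y' s t xy x'x x'y s01 /in13[t01 t1] st.
  have [xy'|nxy'] := boolP (adj x' y').
    have n1 : (x', y') <> (x, y) by case=> E _; rewrite E eqxx in x'x.
    have n2 : (x', y') <> (y, x) by case=> E _; rewrite E eqxx in x'y.
    have [z [sz tz]] := g_cross _ _ _ _ _ _ xy xy' n1 n2 s01 t01 st.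
    have [[zx' _]|[_ E]] := g_vertex _ _ _ _ xy' t01 tz; last by rewrite E eqxx in t1.
    have [[E _]|[E _]] := g_vertex _ _ _ _ xy s01 sz.
      by rewrite -zx' E eqxx in x'x.
    by rewrite -zx' E eqxx in x'y.
  move: st; rewrite (g_nadj x')// => /(g_vertex _ _ _ _ xy s01)[[E _]|[E _]].
    by rewrite E eqxx in x'x.
  by rewrite E eqxx in x'y.
- move=> x y x' y' s t xy xy' n1 n2; rewrite !in_itv /= => /andP[s1 s2] /andP[t1 t2] st.
  have s01 : s \in `[0, 1] by rewrite in_itv /=; apply/andP; split; lra.
  have t01 : t \in `[0, 1] by rewrite in_itv /=; apply/andP; split; lra.
  (* Distinct edges meet only at vertices, where the parameter is 0 or 1, outside the middle
     third. *)
  have [z [sz _]] := g_cross _ _ _ _ _ _ xy xy' n1 n2 s01 t01 st.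
  by have [[_ E]|[_ E]] := g_vertex _ _ _ _ xy s01 sz; move: s1 s2; rewrite E; clear; lra.
Qed.

Theorem corollaryA15 (R : realType) (G H : graph)
  (planarG : planar R G) (planarH : planar R H)
  (qisoGH : quantum_isomorphic R G H) :
  graph_isomorphic G H.
Proof.
apply: grid_minor_isomorphic (planar_grid_minor planarG) (planar_grid_minor planarH) _.
by move=> K e; apply: quantum_isomorphic_card_homs qisoGH.
Qed.
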